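(* For any sentence $\varphi$ of $\mathbb T$, the sequent $\top\vdash\varphi$ is provable in $\mathbb T$ if and only if $\varphi$ is true in the standard model $\mathbb N$.
   Context: Coherent logic: formulas built from atomic formulas (including equalities) using only $\top,\bot,\wedge,\vee,\exists$; sequents $\varphi\vdash_{\bar x}\psi$ derived with the standard coherent deduction system. PrimRec is the set of primitive recursive function descriptions generated from $\mathsf z$ (constant $0$), $\mathsf s$ (successor), projections $\pi^n_k$, composition $\mathrm{Cn}[\mathsf h,\mathsf g_1,\dots,\mathsf g_n]$ and primitive recursion $\mathrm{Pr}[\mathsf g,\mathsf h]$. The coherent arithmetic $\mathbb T$ has a constant $\mathsf 0$, a function symbol for each element of PrimRec, and a binary predicate $<$, with axioms: $\mathsf zx=\mathsf 0$; $\pi^n_k(x_1,\dots,x_n)=x_k$; $\mathsf sx=\mathsf 0\vdash\bot$; $\mathsf sx=\mathsf sy\vdash x=y$; the defining equations of each composition and primitive recursion symbol; $x<y\dashv\vdash\exists z(x+\mathsf sz=y)$ with $+$ the PrimRec addition. Formulas may also use bounded universal quantifiers $\forall z<t\,\varphi$ ($t$ not containing $z$) with the double rule $\psi\vdash\forall z<t\,\varphi$ iff $\psi\wedge z<t\vdash\varphi$ ($z$ not free in $\psi$), and $\mathbb T$ has the induction rules (IndR): from $\psi(\bar x)\vdash\varphi(\bar x,\mathsf 0)$ and $\psi(\bar x)\wedge\varphi(\bar x,y)\vdash\varphi(\bar x,\mathsf sy)$ infer $\psi(\bar x)\vdash_{\bar x,y}\varphi(\bar x,y)$; (IndL): from $\psi(\bar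 x,\mathsf 0)\vdash\varphi(\bar x)$ and $\psi(\bar x,\mathsf sy)\vdash\varphi(\bar x)\vee\psi(\bar x,y)$ infer $\psi(\bar x,y)\vdash_{\bar x,y}\varphi(\bar x)$. The standard model interprets everything in $\mathbb N$ in the usual way. *)

(* Defs.v *)
From mathcomp Require Import all_boot.

Set Implicit Arguments.
Unset Strict Implicit.
Unset Printing Implicit Defensive.

(** Tuples [v_0, ..., v_(n-1)] are functions on ['I_n]; [snoc v a] is
    [v_0, ..., v_(n-1), a]. *)
Definition snoc (T : Type) (n : nat) (v : 'I_n -> T) (a : T) : 'I_n.+1 -> T :=
  fun i => if unlift ord_max i is Some j then v j else a.

(** The index of [primrec] is the arity. Recursion is on the last argument:
    [Pr[g,h](x,0) = g(x)] and [Pr[g,h](x,y+1) = h(x,y,Pr[g,h](x,y))].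
    As the initial functions have positive arity, [primrec 0] is empty. *)
Inductive primrec : nat -> Type :=
| PRzero : primrec 1
| PRsucc : primrec 1
| PRproj (n : nat) (k : 'I_n) : primrec n
| PRcomp (m n : nat) (h : primrec n) (g : {ffun 'I_n -> primrec m}) : primrec m
| PRrec (n : nat) (g : primrec n) (h : primrec n.+2) : primrec n.+1.

(** [x + 0 = x] and [x + s y = s (x + y)]. *)
Definition PRadd : primrec 2 :=
  PRrec (PRproj (ord0 : 'I_1))
        (PRcomp PRsucc [ffun=> PRproj (ord_max : 'I_3)]).

(** [term n] and [form n] are the terms and formulas in a context of [n]
    variables [x_0, ..., x_(n-1)]. A quantifier extends the context at its end:
    in [Ex phi] and [BAll t phi] with [phi : form n.+1], the bound variable is
    [Var ord_max]. The bound [t] of [BAll t phi] lives in the outer context, so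
    it does not contain the bound variable. *)
Inductive term (n : nat) : Type :=
| Var (i : 'I_n)
| Zero
| App (m : nat) (f : primrec m) (ts : {ffun 'I_m -> term n}).

Arguments Zero {n}.

Inductive form : nat -> Type :=
| Top (n : nat) : form n
| Bot (n : nat) : form n
| Eq (n : nat) (t u : term n) : form n
| Lt (n : nat) (t u : term n) : form n
| And (n : nat) (phi psi : form n) : form n
| Or (n : nat) (phi psi : form n) : form n
| Ex (n : nat) (phi : form n.+1) : form n
| BAll (n : nat) (t : term n) (phi : form n.+1) : form n.

Arguments Top {n}.
Arguments Bot {n}.

Definition app (n m : nat) (f : primrec m) (ts : 'I_m -> term n) : term n :=
  App f [ffun i => ts i].

Definition app1 (n : nat) (f : primrec 1) (t : term n) : term n :=
  app f (fun=> t).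

Definition app2 (n : nat) (f : primrec 2) (t u : term n) : term n :=
  app f (snoc (fun=> t) u).

Definition Succ (n : nat) (t : term n) : term n := app1 PRsucc t.

Fixpoint tsubst (n m : nat) (s : 'I_n -> term m) (t : term n) : term m :=
  match t with
  | Var i => s i
  | Zero => Zero
  | App k f ts => App f [ffun i => tsubst s (ts i)]
  end.

Definition wkvar (n : nat) (i : 'I_n) : term n.+1 := Var (lift ord_max i).

Definition twk (n : nat) (t : term n) : term n.+1 := tsubst (@wkvar n) t.

Definition up (n m : nat) (s : 'I_n -> term m) : 'I_n.+1 -> term m.+1 :=
  snoc (fun i => twk (s i)) (Var ord_max).

Fixpoint fsubst (n m : nat) (s : 'I_n -> term m) (phi : form n) : form m :=
  match phi in form n return ('I_n -> term m) -> form m with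
  | Top _ => fun=> Top
  | Bot _ => fun=> Bot
  | Eq _ t u => fun s => Eq (tsubst s t) (tsubst s u)
  | Lt _ t u => fun s => Lt (tsubst s t) (tsubst s u)
  | And _ phi psi => fun s => And (fsubst s phi) (fsubst s psi)
  | Or _ phi psi => fun s => Or (fsubst s phi) (fsubst s psi)
  | Ex _ phi => fun s => Ex (fsubst (up s) phi)
  | BAll _ t phi => fun s => BAll (tsubst s t) (fsubst (up s) phi)
  end s.

(** A formula in the context [x] seen in the context [x, y]. *)
Definition fwk (n : nat) (phi : form n) : form n.+1 := fsubst (@wkvar n) phi.

(** [phi(x, t(x))] in the context [x], for [phi] in the context [x, y]. *)
Definition inst (n : nat) (phi : form n.+1) (t : term n) : form n :=
  fsubst (snoc (@Var n) t) phi.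

(** [phi(x, s y)] in the context [x, y], for [phi] in the context [x, y]. *)
Definition inst_succ (n : nat) (phi : form n.+1) : form n.+1 :=
  fsubst (snoc (@wkvar n) (Succ (Var ord_max))) phi.

(** [axiomT phi psi] : the sequent [phi |- psi], in the context given by the
    type of [phi] and [psi], is a non-logical axiom. *)
Inductive axiomT : forall n : nat, form n -> form n -> Prop :=
| ax_zero :
    @axiomT 1 Top (Eq (app1 PRzero (Var ord0)) Zero)
| ax_proj (n : nat) (k : 'I_n) :
    @axiomT n Top (Eq (app (PRproj k) (@Var n)) (Var k))
| ax_succ_neq0 :
    @axiomT 1 (Eq (Succ (Var ord0)) Zero) Bot
| ax_succ_inj :
    @axiomT 2 (Eq (Succ (Var ord0)) (Succ (Var ord_max)))
              (Eq (Var ord0) (Var ord_max))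
| ax_comp (m n : nat) (h : primrec n) (g : {ffun 'I_n -> primrec m}) :
    @axiomT m Top (Eq (app (PRcomp h g) (@Var m))
                      (app h (fun i => app (g i) (@Var m))))
| ax_rec0 (n : nat) (g : primrec n) (h : primrec n.+2) :
    @axiomT n Top (Eq (app (PRrec g h) (snoc (@Var n) Zero))
                      (app g (@Var n)))
| ax_recS (n : nat) (g : primrec n) (h : primrec n.+2) :
    @axiomT n.+1 Top
      (Eq (app (PRrec g h) (snoc (@wkvar n) (Succ (Var ord_max))))
          (app h (snoc (@Var n.+1) (app (PRrec g h) (@Var n.+1)))))
| ax_lt_ex :
    @axiomT 2 (Lt (Var ord0) (Var ord_max))
      (Ex (Eq (app2 PRadd (twk (Var ord0)) (Succ (Var ord_max)))
              (twk (Var ord_max))))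
| ax_ex_lt :
    @axiomT 2
      (Ex (Eq (app2 PRadd (twk (Var ord0)) (Succ (Var ord_max)))
              (twk (Var ord_max))))
      (Lt (Var ord0) (Var ord_max)).

Reserved Notation "phi |-[ n ] psi"
  (at level 70, n at level 50, psi at next level, format "phi  |-[ n ]  psi").

(** [phi |-[n] psi] : the sequent [phi |- psi] in the context
    [x_0, ..., x_(n-1)] is provable. The logical rules are the sequent rules of
    coherent logic in context, with the distributivity and Frobenius axioms. *)
Inductive entails : forall n : nat, form n -> form n -> Prop :=
| ent_axiom n (phi psi : form n) :
    axiomT phi psi -> phi |-[n] psi
| ent_id n (phi : form n) :
    phi |-[n] phi
| ent_subst n m (s : 'I_n -> term m) (phi psi : form n) :
    phi |-[n] psi -> fsubst s phi |-[m] fsubst s psi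
| ent_cut n (phi psi chi : form n) :
    phi |-[n] psi -> psi |-[n] chi -> phi |-[n] chi
| ent_eq_refl n (t : term n) :
    Top |-[n] Eq t t
| ent_eq_subst n (t u : term n) (phi : form n.+1) :
    And (Eq t u) (inst phi t) |-[n] inst phi u
| ent_top n (phi : form n) :
    phi |-[n] Top
| ent_and_l n (phi psi : form n) :
    And phi psi |-[n] phi
| ent_and_r n (phi psi : form n) :
    And phi psi |-[n] psi
| ent_and n (phi psi chi : form n) :
    phi |-[n] psi -> phi |-[n] chi -> phi |-[n] And psi chi
| ent_bot n (phi : form n) :
    Bot |-[n] phi
| ent_or_l n (phi psi : form n) :
    phi |-[n] Or phi psi
| ent_or_r n (phi psi : form n) :
    psi |-[n] Or phi psi
| ent_or n (phi psi chi : form n) :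
    phi |-[n] chi -> psi |-[n] chi -> Or phi psi |-[n] chi
| ent_distr n (phi psi chi : form n) :
    And phi (Or psi chi) |-[n] Or (And phi psi) (And phi chi)
| ent_ex n (phi : form n.+1) (psi : form n) :
    phi |-[n.+1] fwk psi -> Ex phi |-[n] psi
| ent_ex_inv n (phi : form n.+1) (psi : form n) :
    Ex phi |-[n] psi -> phi |-[n.+1] fwk psi
| ent_frobenius n (phi : form n) (psi : form n.+1) :
    And phi (Ex psi) |-[n] Ex (And (fwk phi) psi)
| ent_ball n (t : term n) (phi : form n.+1) (psi : form n) :
    And (fwk psi) (Lt (Var ord_max) (twk t)) |-[n.+1] phi ->
    psi |-[n] BAll t phi
| ent_ball_inv n (t : term n) (phi : form n.+1) (psi : form n) :
    psi |-[n] BAll t phi ->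
    And (fwk psi) (Lt (Var ord_max) (twk t)) |-[n.+1] phi
| ent_indR n (psi : form n) (phi : form n.+1) :
    psi |-[n] inst phi Zero ->
    And (fwk psi) phi |-[n.+1] inst_succ phi ->
    fwk psi |-[n.+1] phi
| ent_indL n (psi : form n.+1) (phi : form n) :
    inst psi Zero |-[n] phi ->
    inst_succ psi |-[n.+1] Or (fwk phi) psi ->
    psi |-[n.+1] fwk phi
where "phi |-[ n ] psi" := (@entails n phi psi).

Fixpoint PReval (n : nat) (f : primrec n) : ('I_n -> nat) -> nat :=
  match f in primrec n return ('I_n -> nat) -> nat with
  | PRzero => fun=> 0
  | PRsucc => fun v => (v ord0).+1
  | PRproj n k => fun v => v k
  | PRcomp m n h g => fun v => PReval h (fun i => PReval (g i) v)
  | PRrec n g h => fun v =>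
      let x := fun i => v (lift ord_max i) in
      nat_rect (fun=> nat) (PReval g x)
        (fun y r => PReval h (snoc (snoc x y) r)) (v ord_max)
  end.

Fixpoint teval (n : nat) (v : 'I_n -> nat) (t : term n) : nat :=
  match t with
  | Var i => v i
  | Zero => 0
  | App m f ts => PReval f (fun i => teval v (ts i))
  end.

Fixpoint sat (n : nat) (v : 'I_n -> nat) (phi : form n) : Prop :=
  match phi in form n return ('I_n -> nat) -> Prop with
  | Top _ => fun=> True
  | Bot _ => fun=> False
  | Eq _ t u => fun v => teval v t = teval v u
  | Lt _ t u => fun v => teval v t < teval v u
  | And _ phi psi => fun v => sat v phi /\ sat v psi
  | Or _ phi psi => fun v => sat v phi \/ sat v psi
  | Ex _ phi => fun v => exists a : nat, sat (snoc v a) phi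
  | BAll _ t phi => fun v =>
      forall a : nat, a < teval v t -> sat (snoc v a) phi
  end v.

Definition sentence : Type := form 0.

Definition provable (phi : sentence) : Prop := Top |-[0] phi.

(** The value [0] is never used, since ['I_0] is empty. *)
Definition true_in_N (phi : sentence) : Prop := sat (fun _ : 'I_0 => 0) phi.

(* Main.v *)
From Stdlib Require Import FunctionalExtensionality Setoid.
From mathcomp Require Import all_boot.
Require Import Defs.

Set Implicit Arguments.
Unset Strict Implicit.
Unset Printing Implicit Defensive.

(** Soundness is an induction on derivations. For completeness, each primitive
    recursive symbol applied to numerals provably equals the numeral of its
    value, by induction on its description. Hence every formula true at [v]
    becomes provable once the numerals of [v] are substituted, by induction on
    the formula. A quantifier bounded by the numeral of [k] is treated by
    induction on [k]: as [z < s t] entails [z < t] or [z = t], the formula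
    [forall z < s t, phi z] follows from [forall z < t, phi z] and [phi t]. *)

(** * Tuples *)

Lemma snoc_max (T : Type) n (v : 'I_n -> T) a : snoc v a ord_max = a.
Proof. by rewrite /snoc unlift_none. Qed.

Lemma snoc_lift (T : Type) n (v : 'I_n -> T) a i :
  snoc v a (lift ord_max i) = v i.
Proof. by rewrite /snoc liftK. Qed.

Lemma snoc_ord0 (T : Type) n (v : 'I_n.+1 -> T) a : snoc v a ord0 = v ord0.
Proof.
rewrite (_ : ord0 = lift ord_max (ord0 : 'I_n.+1)) ?snoc_lift //.
exact: val_inj.
Qed.

Lemma eq_snoc (T : Type) n (v w : 'I_n.+1 -> T) :
  (forall i, v (lift ord_max i) = w (lift ord_max i)) ->
  v ord_max = w ord_max -> v = w.
Proof.
move=> eq_lift eq_max; apply: functional_extensionality => i.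
by case: (unliftP ord_max i) => [j ->|->].
Qed.

Lemma snoc_eta (T : Type) n (v : 'I_n.+1 -> T) :
  snoc (fun i => v (lift ord_max i)) (v ord_max) = v.
Proof. by apply: eq_snoc => [i|]; rewrite ?snoc_lift ?snoc_max. Qed.

Lemma snoc_case (T : Type) n (P : ('I_n.+1 -> T) -> Prop) :
  (forall v a, P (snoc v a)) -> forall v, P v.
Proof. by move=> Psnoc v; rewrite -(snoc_eta v). Qed.

Lemma snocK (T : Type) n (v : 'I_n -> T) a :
  (fun i => snoc v a (lift ord_max i)) = v.
Proof. by apply: functional_extensionality => i; rewrite snoc_lift. Qed.

Lemma comp_snoc (T U : Type) (f : T -> U) n (v : 'I_n -> T) a :
  (fun i => f (snoc v a i)) = snoc (fun i => f (v i)) (f a).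
Proof. by apply: eq_snoc => [i|]; rewrite ?snoc_lift ?snoc_max. Qed.

Lemma snoc_rel (T U : Type) (R : T -> U -> Prop) n (v : 'I_n -> T)
    (w : 'I_n -> U) a b :
  (forall i, R (v i) (w i)) -> R a b -> forall i, R (snoc v a i) (snoc w b i).
Proof.
move=> Rvw Rab i.
by case: (unliftP ord_max i) => [j ->|->]; rewrite ?snoc_lift ?snoc_max.
Qed.

(* The generated induction principles give no hypothesis for the arguments
   stored in finite functions. *)
Fixpoint term_nested_ind (n : nat) (P : term n -> Prop)
    (Pvar : forall i, P (Var i)) (Pzero : P Zero)
    (Papp : forall m (f : primrec m) (ts : {ffun 'I_m -> term n}),
       (forall i, P (ts i)) -> P (App f ts)) (t : term n) : P t :=
  match t with
  | Var i => Pvar i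
  | Zero => Pzero
  | App m f ts =>
      Papp m f ts (fun i => term_nested_ind Pvar Pzero Papp (ts i))
  end.

Fixpoint primrec_nested_ind (P : forall n, primrec n -> Prop)
    (Pzero : P 1 PRzero) (Psucc : P 1 PRsucc)
    (Pproj : forall n (k : 'I_n), P n (PRproj k))
    (Pcomp : forall m n (h : primrec n) (g : {ffun 'I_n -> primrec m}),
       P n h -> (forall i, P m (g i)) -> P m (PRcomp h g))
    (Prec : forall n (g : primrec n) (h : primrec n.+2),
       P n g -> P n.+2 h -> P n.+1 (PRrec g h))
    (n : nat) (f : primrec n) : P n f :=
  let IH := primrec_nested_ind Pzero Psucc Pproj Pcomp Prec in
  match f with
  | PRzero => Pzero
  | PRsucc => Psucc
  | PRproj n k => Pproj n k
  | PRcomp m n h g => Pcomp m n h g (IH n h) (fun i => IH m (g i))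
  | PRrec n g h => Prec n g h (IH n g) (IH n.+2 h)
  end.

(** * Substitution *)

Lemma tsubst_app n m (s : 'I_n -> term m) k (f : primrec k) ts :
  tsubst s (app f ts) = app f (fun i => tsubst s (ts i)).
Proof. by congr App; apply/ffunP => i; rewrite !ffunE. Qed.

Lemma tsubst_Succ n m (s : 'I_n -> term m) t :
  tsubst s (Succ t) = Succ (tsubst s t).
Proof. exact: tsubst_app. Qed.

Lemma twk_Succ n (t : term n) : twk (Succ t) = Succ (twk t).
Proof. exact: tsubst_Succ. Qed.

Lemma tsubst_app2 n m (s : 'I_n -> term m) f t u :
  tsubst s (app2 f t u) = app2 f (tsubst s t) (tsubst s u).
Proof. by rewrite /app2 tsubst_app comp_snoc. Qed.

Lemma tsubst_comp n m k (s : 'I_m -> term k) (r : 'I_n -> term m) t :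
  tsubst s (tsubst r t) = tsubst (fun i => tsubst s (r i)) t.
Proof.
elim/term_nested_ind: t => //= l f ts IH.
by congr App; apply/ffunP => i; rewrite !ffunE.
Qed.

Lemma tsubst_id n (t : term n) : tsubst (@Var n) t = t.
Proof.
elim/term_nested_ind: t => //= l f ts IH.
by congr App; apply/ffunP => i; rewrite ffunE.
Qed.

Lemma tsubst_snoc_twk n m (s : 'I_n -> term m) u t :
  tsubst (snoc s u) (twk t) = tsubst s t.
Proof. by rewrite /twk tsubst_comp /= snocK. Qed.

Lemma tsubst_inst_twk n (u t : term n) : tsubst (snoc (@Var n) u) (twk t) = t.
Proof. by rewrite tsubst_snoc_twk tsubst_id. Qed.

Lemma tsubst_up_twk n m (s : 'I_n -> term m) t :
  tsubst (up s) (twk t) = twk (tsubst s t).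
Proof. by rewrite /up tsubst_snoc_twk /twk tsubst_comp. Qed.

Lemma up_comp n m k (s : 'I_m -> term k) (r : 'I_n -> term m) :
  (fun i => tsubst (up s) (up r i)) = up (fun i => tsubst s (r i)).
Proof.
rewrite (comp_snoc (tsubst (up s))) /= {2}/up snoc_max /up; congr snoc.
by apply: functional_extensionality => i; apply: tsubst_up_twk.
Qed.

Lemma up_Var n : up (@Var n) = @Var n.+1.
Proof. exact: snoc_eta. Qed.

Lemma fsubst_comp n (phi : form n) : forall m k (s : 'I_m -> term k) r,
  fsubst s (fsubst r phi) = fsubst (fun i => tsubst s (r i)) phi.
Proof.
elim: phi => //= {n}.
- by move=> n t u m k s r; rewrite !tsubst_comp.
- by move=> n t u m k s r; rewrite !tsubst_comp.
- by move=> n phi IHphi psi IHpsi m k s r; rewrite IHphi IHpsi.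
- by move=> n phi IHphi psi IHpsi m k s r; rewrite IHphi IHpsi.
- by move=> n phi IH m k s r; rewrite IH up_comp.
- by move=> n t phi IH m k s r; rewrite IH up_comp tsubst_comp.
Qed.

Lemma fsubst_id n (phi : form n) : fsubst (@Var n) phi = phi.
Proof.
elim: phi => //= {n}.
- by move=> n t u; rewrite !tsubst_id.
- by move=> n t u; rewrite !tsubst_id.
- by move=> n phi IHphi psi IHpsi; rewrite IHphi IHpsi.
- by move=> n phi IHphi psi IHpsi; rewrite IHphi IHpsi.
- by move=> n phi IH; rewrite up_Var IH.
- by move=> n t phi IH; rewrite up_Var IH tsubst_id.
Qed.

Lemma inst_fwk n (phi : form n) t : inst (fwk phi) t = phi.
Proof. by rewrite /inst /fwk fsubst_comp /= snocK fsubst_id. Qed.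

Lemma fwk_inst n (phi : form n.+1) t :
  fwk (inst phi t) = fsubst (snoc (@wkvar n) (twk t)) phi.
Proof. by rewrite /fwk /inst fsubst_comp (comp_snoc (tsubst (@wkvar n))). Qed.

Lemma inst_fsubst_up n m (s : 'I_n -> term m) phi t :
  inst (fsubst (up s) phi) t = fsubst (snoc s t) phi.
Proof.
rewrite /inst fsubst_comp /up (comp_snoc (tsubst _)) /= snoc_max.
congr (fsubst (snoc _ _) _); apply: functional_extensionality => i.
exact: tsubst_inst_twk.
Qed.

(** * Soundness *)

Lemma teval_app n m (v : 'I_n -> nat) (f : primrec m) ts :
  teval v (app f ts) = PReval f (fun i => teval v (ts i)).
Proof.
by congr PReval; apply: functional_extensionality => i; rewrite ffunE.
Qed.

Lemma teval_tsubst n m (s : 'I_n -> term m) v t :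
  teval v (tsubst s t) = teval (fun i => teval v (s i)) t.
Proof.
elim/term_nested_ind: t => //= l f ts IH.
by congr PReval; apply: functional_extensionality => i; rewrite ffunE.
Qed.

Lemma teval_twk n (v : 'I_n -> nat) a t : teval (snoc v a) (twk t) = teval v t.
Proof. by rewrite teval_tsubst /= snocK. Qed.

Lemma teval_up n m (s : 'I_n -> term m) v a :
  (fun i => teval (snoc v a) (up s i)) = snoc (fun i => teval v (s i)) a.
Proof.
rewrite (comp_snoc (teval _)) /= snoc_max; congr snoc.
by apply: functional_extensionality => i; apply: teval_twk.
Qed.

Lemma sat_fsubst n (phi : form n) : forall m (s : 'I_n -> term m) v,
  sat v (fsubst s phi) <-> sat (fun i => teval v (s i)) phi.
Proof.
elim: phi => //= {n}.
- by move=> n t u m s v; rewrite !teval_tsubst.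
- by move=> n t u m s v; rewrite !teval_tsubst.
- by move=> n phi IHphi psi IHpsi m s v; rewrite IHphi IHpsi.
- by move=> n phi IHphi psi IHpsi m s v; rewrite IHphi IHpsi.
- move=> n phi IH m s v; split=> -[a sat_phi]; exists a; move: sat_phi;
  by rewrite IH teval_up.
- move=> n t phi IH m s v; rewrite teval_tsubst; split=> sat_phi a /sat_phi;
  by rewrite IH teval_up.
Qed.

Lemma sat_fwk n (phi : form n) v a : sat (snoc v a) (fwk phi) <-> sat v phi.
Proof. by rewrite sat_fsubst /= snocK. Qed.

Lemma sat_inst n (phi : form n.+1) t v :
  sat v (inst phi t) <-> sat (snoc v (teval v t)) phi.
Proof. by rewrite sat_fsubst (comp_snoc (teval v)). Qed.

Lemma sat_inst_succ n (phi : form n.+1) v a :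
  sat (snoc v a) (inst_succ phi) <-> sat (snoc v a.+1) phi.
Proof.
by rewrite sat_fsubst (comp_snoc (teval _)) teval_app /= snoc_max snocK.
Qed.

Lemma PReval_rec0 n (g : primrec n) h x :
  PReval (PRrec g h) (snoc x 0) = PReval g x.
Proof. by rewrite /= snoc_max snocK. Qed.

Lemma PReval_recS n (g : primrec n) h x y :
  PReval (PRrec g h) (snoc x y.+1) =
  PReval h (snoc (snoc x y) (PReval (PRrec g h) (snoc x y))).
Proof. by rewrite /= !snoc_max !snocK. Qed.

Lemma PReval_PRadd x y : PReval PRadd (snoc (fun=> x) y) = x + y.
Proof.
elim: y => [|y IH]; first by rewrite PReval_rec0 addn0.
by rewrite PReval_recS -/PRadd IH /= ffunE /= snoc_max addnS.
Qed.

Lemma teval_PRadd n (v : 'I_n -> nat) t u :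
  teval v (app2 PRadd t u) = teval v t + teval v u.
Proof. by rewrite teval_app (comp_snoc (teval v)) PReval_PRadd. Qed.

Lemma axiomT_sound n (phi psi : form n) v :
  axiomT phi psi -> sat v phi -> sat v psi.
Proof.
move=> ax; case: ax v => {n phi psi}.
- by [].
- by move=> n k v _; rewrite /= ffunE.
- by move=> v; rewrite /= ffunE.
- by move=> v; rewrite /= !ffunE => -[].
- move=> m n h g v _; rewrite /sat !teval_app; apply: (congr1 (PReval h)).
  by apply: functional_extensionality => i; rewrite teval_app.
- move=> n g h v _; rewrite /sat !teval_app (comp_snoc (teval v)).
  exact: PReval_rec0.
- move=> n g h; elim/snoc_case => x y _.
  rewrite /sat !teval_app !(comp_snoc (teval _)) !teval_app /=.
  by rewrite !snoc_max !snocK.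
- move=> v lt_v; exists (v ord_max - (v ord0).+1).
  rewrite /sat !teval_twk teval_PRadd teval_twk teval_app /= snoc_max.
  by rewrite addnS -addSn subnKC.
- move=> v [a]; rewrite /sat !teval_twk teval_PRadd teval_twk.
  by rewrite teval_app /= snoc_max => <-; rewrite addnS ltnS leq_addr.
Qed.

Lemma entails_sound n (phi psi : form n) :
  phi |-[n] psi -> forall v, sat v phi -> sat v psi.
Proof.
elim=> {n phi psi} //=.
- by move=> n phi psi ax v; exact: axiomT_sound.
- by move=> n m s phi psi _ IH v; rewrite !sat_fsubst; exact: IH.
- by move=> n phi psi chi _ IHpsi _ IHchi v /IHpsi/IHchi.
- by move=> n t u phi v [tu]; rewrite !sat_inst tu.
- by move=> n phi psi v [].
- by move=> n phi psi v [].
- move=> n phi psi chi _ IHpsi _ IHchi v sat_phi.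
  by split; [exact: IHpsi|exact: IHchi].
- by move=> n phi psi v; left.
- by move=> n phi psi v; right.
- by move=> n phi psi chi _ IHphi _ IHpsi v [/IHphi|/IHpsi].
- by move=> n phi psi chi v [sat_phi [sat_psi|sat_chi]]; [left|right].
- by move=> n phi psi _ IH v [a /IH]; rewrite sat_fwk.
- move=> n phi psi _ IH; elim/snoc_case => v a sat_phi; rewrite sat_fwk.
  by apply: IH; exists a.
- by move=> n phi psi v [sat_phi [a sat_psi]]; exists a; rewrite sat_fwk.
- move=> n t phi psi _ IH v sat_psi a lt_at; apply: IH.
  by rewrite sat_fwk snoc_max teval_twk.
- move=> n t phi psi _ IH; elim/snoc_case => v a.
  by rewrite sat_fwk snoc_max teval_twk => -[sat_psi]; exact: IH.
- move=> n psi phi _ IH0 _ IHS; elim/snoc_case => v a; rewrite sat_fwk => psiv.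
  elim: a => [|a phia]; first by move/IH0: psiv; rewrite sat_inst.
  by rewrite -sat_inst_succ; apply: IHS; rewrite sat_fwk.
- move=> n psi phi _ IH0 _ IHS; elim/snoc_case => v a; rewrite sat_fwk.
  elim: a => [|a IHa]; first by move=> psi0; apply: IH0; rewrite sat_inst.
  by rewrite -sat_inst_succ => /IHS [|/IHa]; rewrite ?sat_fwk.
Qed.

(** * Derived rules *)

Lemma ent_of_top n (psi phi : form n) : Top |-[n] phi -> psi |-[n] phi.
Proof. exact: ent_cut (ent_top _). Qed.

Lemma ent_or_elim n (psi phi1 phi2 chi : form n) :
  psi |-[n] Or phi1 phi2 -> And psi phi1 |-[n] chi -> And psi phi2 |-[n] chi ->
  psi |-[n] chi.
Proof.
move=> psi_or ent1 ent2; apply: ent_cut (ent_or ent1 ent2).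
by apply: ent_cut (ent_distr _ _ _); apply: ent_and => //; exact: ent_id.
Qed.

Lemma ent_ex_elim n (psi chi : form n) (phi : form n.+1) :
  And (fwk psi) phi |-[n.+1] fwk chi -> And psi (Ex phi) |-[n] chi.
Proof.
by move=> ent_chi; exact: ent_cut (ent_frobenius _ _) (ent_ex ent_chi).
Qed.

Lemma ent_ex_intro n (psi : form n) (phi : form n.+1) t :
  psi |-[n] inst phi t -> psi |-[n] Ex phi.
Proof.
move=> phit; apply: ent_cut phit _.
have := ent_subst (snoc (@Var n) t) (ent_ex_inv (ent_id (Ex phi))).
by rewrite -!/(inst _ _) inst_fwk.
Qed.

Lemma ent_fwk n (psi phi : form n) chi :
  psi |-[n] phi -> And (fwk psi) chi |-[n.+1] fwk phi.
Proof.
by move=> ent_phi; exact: ent_cut (ent_and_l _ _) (ent_subst _ ent_phi).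
Qed.

Lemma ent_axiom_subst n m (s : 'I_n -> term m) (phi chi : form n) psi :
  axiomT phi chi -> psi |-[m] fsubst s phi -> psi |-[m] fsubst s chi.
Proof.
by move=> ax ent_phi; exact: ent_cut ent_phi (ent_subst s (ent_axiom ax)).
Qed.

(** * Equality *)

Section Equality.

Variables (n : nat) (psi : form n).
Implicit Types t u w : term n.

Lemma ent_eqxx t : psi |-[n] Eq t t.
Proof. exact: ent_of_top (ent_eq_refl t). Qed.

Lemma ent_replace (phi : form n.+1) t u :
  psi |-[n] Eq t u -> psi |-[n] inst phi t -> psi |-[n] inst phi u.
Proof.
by move=> tu phit; exact: ent_cut (ent_and tu phit) (ent_eq_subst _ _ _).
Qed.

Lemma ent_eq_sym t u : psi |-[n] Eq t u -> psi |-[n] Eq u t.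
Proof.
move/(ent_replace (phi := Eq (Var ord_max) (twk t))).
rewrite /inst /= !snoc_max !tsubst_inst_twk; apply; exact: ent_eqxx.
Qed.

Lemma ent_eq_trans t u w :
  psi |-[n] Eq t u -> psi |-[n] Eq u w -> psi |-[n] Eq t w.
Proof.
move=> tu /(ent_replace (phi := Eq (twk t) (Var ord_max))).
by rewrite /inst /= !snoc_max !tsubst_inst_twk; apply.
Qed.

Lemma ent_lt_congr t t' u u' :
  psi |-[n] Eq t t' -> psi |-[n] Eq u u' ->
  psi |-[n] Lt t u -> psi |-[n] Lt t' u'.
Proof.
move=> /(ent_replace (phi := Lt (Var ord_max) (twk u))) replace_t.
move=> /(ent_replace (phi := Lt (twk t') (Var ord_max))).
move: replace_t; rewrite /inst /= !snoc_max !tsubst_inst_twk.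
by move=> replace_t replace_u /replace_t.
Qed.

Lemma ent_app_update m (f : primrec m) (ts : 'I_m -> term n) j u :
  psi |-[n] Eq (ts j) u ->
  psi |-[n] Eq (app f ts) (app f [eta ts with j |-> u]).
Proof.
pose phi := Eq (twk (app f ts))
  (app f [eta fun i => twk (ts i) with j |-> Var ord_max]).
have instE w : inst phi w = Eq (app f ts) (app f [eta ts with j |-> w]).
  rewrite /inst /phi /fsubst tsubst_inst_twk tsubst_app.
  congr (Eq _ (app f _)); apply: functional_extensionality => i /=.
  by case: eqP => _; rewrite ?tsubst_inst_twk //= snoc_max.
move=> /(ent_replace (phi := phi)); rewrite !instE; apply.
rewrite (_ : [eta _ with _ |-> _] = ts :> (_ -> _)); first exact: ent_eqxx.
by apply: functional_extensionality => i /=; case: eqP => [->|].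
Qed.

Lemma ent_app_congr m (f : primrec m) ts us :
  (forall i, psi |-[n] Eq (ts i) (us i)) -> psi |-[n] Eq (app f ts) (app f us).
Proof.
(* The arguments in [e] are replaced one at a time. *)
suff ent_e (e : seq 'I_m) : (forall i, i \notin e -> ts i = us i) ->
    (forall i, psi |-[n] Eq (ts i) (us i)) ->
    psi |-[n] Eq (app f ts) (app f us).
  by apply: (ent_e (enum 'I_m)) => i; rewrite mem_enum.
elim: e ts => [|j e IH] ts eq_out ent_eq.
  have -> : ts = us by apply: functional_extensionality => i; exact: eq_out.
  exact: ent_eqxx.
apply: ent_eq_trans (ent_app_update f (ent_eq j)) (IH _ _ _) => i /=.
  by case: eqP => [->|/eqP ne_ij] // ie; rewrite eq_out // inE negb_or ne_ij.
by case: eqP => [->|] //; exact: ent_eqxx.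
Qed.

Lemma ent_app2_congr (f : primrec 2) t t' u u' :
  psi |-[n] Eq t t' -> psi |-[n] Eq u u' ->
  psi |-[n] Eq (app2 f t u) (app2 f t' u').
Proof.
move=> tt' uu'; apply: ent_app_congr.
exact: (snoc_rel (R := fun t u => psi |-[n] Eq t u)).
Qed.

End Equality.

Lemma ent_one_point n (psi : form n) (phi : form n.+1) t :
  psi |-[n] inst phi t ->
  And (fwk psi) (Eq (Var ord_max) (twk t)) |-[n.+1] phi.
Proof.
move=> /(ent_fwk (Eq (Var ord_max) (twk t))); rewrite fwk_inst -inst_fsubst_up.
move/(ent_replace (ent_eq_sym (ent_and_r _ _))).
by rewrite inst_fsubst_up [snoc _ _](snoc_eta (@Var n.+1)) fsubst_id.
Qed.

(** * Arithmetic *)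

Section Arithmetic.

Variables (n : nat) (psi : form n).
Implicit Types t u w : term n.

Lemma ent_PRzero t : psi |-[n] Eq (app1 PRzero t) Zero.
Proof.
have := ent_axiom_subst (s := fun=> t) ax_zero (ent_top psi).
by rewrite /fsubst tsubst_app.
Qed.

Lemma ent_PRproj m (k : 'I_m) ts : psi |-[n] Eq (app (PRproj k) ts) (ts k).
Proof.
have := ent_axiom_subst (s := ts) (ax_proj k) (ent_top psi).
by rewrite /fsubst tsubst_app.
Qed.

Lemma ent_PRcomp m k (h : primrec k) (g : {ffun 'I_k -> primrec m}) ts :
  psi |-[n] Eq (app (PRcomp h g) ts) (app h (fun i => app (g i) ts)).
Proof.
have := ent_axiom_subst (s := ts) (ax_comp h g) (ent_top psi).
rewrite /fsubst !tsubst_app; congr (entails _ (Eq _ (app h _))).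
by apply: functional_extensionality => i; rewrite tsubst_app.
Qed.

Lemma ent_PRrec0 m (g : primrec m) h ts :
  psi |-[n] Eq (app (PRrec g h) (snoc ts Zero)) (app g ts).
Proof.
have := ent_axiom_subst (s := ts) (ax_rec0 g h) (ent_top psi).
by rewrite /fsubst !tsubst_app (comp_snoc (tsubst _)).
Qed.

Lemma ent_PRrecS m (g : primrec m) h ts u :
  psi |-[n] Eq (app (PRrec g h) (snoc ts (Succ u)))
               (app h (snoc (snoc ts u) (app (PRrec g h) (snoc ts u)))).
Proof.
have := ent_axiom_subst (s := snoc ts u) (ax_recS g h) (ent_top psi).
rewrite /fsubst !tsubst_app !(comp_snoc (tsubst _)) tsubst_Succ tsubst_app /=.
by rewrite snoc_max snocK.
Qed.

Lemma ent_add0 t : psi |-[n] Eq (app2 PRadd t Zero) t.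
Proof. exact: ent_eq_trans (ent_PRrec0 _ _ _) (ent_PRproj _ _). Qed.

Lemma ent_addS t u :
  psi |-[n] Eq (app2 PRadd t (Succ u)) (Succ (app2 PRadd t u)).
Proof.
apply: ent_eq_trans (ent_PRrecS _ _ _ _) _.
apply: ent_eq_trans (ent_PRcomp _ _ _) _.
apply: ent_app_congr => i; rewrite ffunE.
by apply: ent_eq_trans (ent_PRproj _ _) _; rewrite snoc_max; exact: ent_eqxx.
Qed.

Lemma ent_Succ_inj t u : psi |-[n] Eq (Succ t) (Succ u) -> psi |-[n] Eq t u.
Proof.
have := ent_axiom_subst (psi := psi) (s := snoc (fun=> t) u) ax_succ_inj.
by rewrite /fsubst !tsubst_Succ /= snoc_ord0 snoc_max.
Qed.

Lemma ent_Succ_neq0 chi t : psi |-[n] Eq (Succ t) Zero -> psi |-[n] chi.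
Proof.
have := ent_axiom_subst (psi := psi) (s := fun=> t) ax_succ_neq0.
by rewrite /fsubst tsubst_Succ => absurd /absurd/ent_cut; apply; exact: ent_bot.
Qed.

End Arithmetic.

Definition zero_or_succ n (t : term n) : form n :=
  Or (Eq t Zero) (Ex (Eq (twk t) (Succ (Var ord_max)))).

Lemma fsubst_zero_or_succ n m (s : 'I_n -> term m) t :
  fsubst s (zero_or_succ t) = zero_or_succ (tsubst s t).
Proof.
by rewrite /zero_or_succ /fsubst tsubst_up_twk tsubst_Succ /= /up snoc_max.
Qed.

Lemma ent_zero_or_succ n (psi : form n) t : psi |-[n] zero_or_succ t.
Proof.
apply: ent_of_top.
have zero_or_succ_var : Top |-[n.+1] zero_or_succ (Var ord_max).
  apply: (@ent_indR n Top).
    rewrite /inst fsubst_zero_or_succ /= snoc_max.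
    exact: ent_cut (ent_eq_refl _) (ent_or_l _ _).
  rewrite /inst_succ fsubst_zero_or_succ /= snoc_max.
  apply: ent_cut (ent_or_r _ _); apply: (ent_ex_intro (t := Var ord_max)).
  rewrite /inst /fsubst tsubst_inst_twk tsubst_Succ /= snoc_max.
  exact: ent_eqxx.
have := ent_subst (snoc (@Var n) t) zero_or_succ_var.
by rewrite fsubst_zero_or_succ /= snoc_max.
Qed.

Definition lt_witness n (t u : term n) : form n.+1 :=
  Eq (app2 PRadd (twk t) (Succ (Var ord_max))) (twk u).

Lemma fsubst_up_lt_witness n m (s : 'I_n -> term m) t u :
  fsubst (up s) (lt_witness t u) = lt_witness (tsubst s t) (tsubst s u).
Proof.
rewrite /lt_witness /fsubst tsubst_app2 !tsubst_up_twk tsubst_Succ /=.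
by rewrite /up snoc_max.
Qed.

Lemma ent_lt_ex n (psi : form n) t u :
  psi |-[n] Lt t u -> psi |-[n] Ex (lt_witness t u).
Proof.
have := ent_axiom_subst (psi := psi) (s := snoc (fun=> t) u) ax_lt_ex.
rewrite -/(lt_witness _ _) /fsubst -/fsubst fsubst_up_lt_witness /=.
by rewrite snoc_ord0 snoc_max.
Qed.

Lemma ent_ex_lt n (psi : form n) t u :
  psi |-[n] Ex (lt_witness t u) -> psi |-[n] Lt t u.
Proof.
have := ent_axiom_subst (psi := psi) (s := snoc (fun=> t) u) ax_ex_lt.
rewrite -/(lt_witness _ _) /fsubst -/fsubst fsubst_up_lt_witness /=.
by rewrite snoc_ord0 snoc_max.
Qed.

Lemma ent_lt_elim n (t u : term n) chi :
  lt_witness t u |-[n.+1] fwk chi -> Lt t u |-[n] chi.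
Proof.
move=> wit_chi; apply: ent_cut (ent_lt_ex (ent_id _)) _; exact: ent_ex.
Qed.

Lemma ent_lt_intro n (psi : form n) t u w :
  psi |-[n] Eq (app2 PRadd t (Succ w)) u -> psi |-[n] Lt t u.
Proof.
move=> add_eq; apply: ent_ex_lt; apply: (ent_ex_intro (t := w)).
rewrite /inst /lt_witness /fsubst tsubst_app2 tsubst_Succ !tsubst_inst_twk /=.
by rewrite snoc_max.
Qed.

Lemma ent_lt0 n (t : term n) chi : Lt t Zero |-[n] chi.
Proof.
apply: ent_lt_elim; apply: ent_Succ_neq0.
exact: ent_eq_trans (ent_eq_sym (ent_addS _ _ _)) (ent_id _).
Qed.

(* From [t + s z = s u] follows [t + z = u]; then [z = 0] gives [t = u], and
   [z = s w] gives [t < u]. *)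
Lemma ent_lt_succ n (t u : term n) : Lt t (Succ u) |-[n] Or (Lt t u) (Eq t u).
Proof.
apply: ent_lt_elim; rewrite /lt_witness twk_Succ.
set z := Var _; set psi := Eq _ _.
have add_z : psi |-[n.+1] Eq (app2 PRadd (twk t) z) (twk u).
  apply: ent_Succ_inj.
  exact: ent_eq_trans (ent_eq_sym (ent_addS _ _ _)) (ent_id _).
apply: ent_or_elim (ent_zero_or_succ _ z) _ _.
  apply: ent_cut (ent_or_r _ _).
  apply: ent_eq_trans (ent_cut (ent_and_l _ _) add_z).
  apply: ent_eq_trans (ent_eq_sym (ent_add0 _ _)) _.
  exact: ent_app2_congr (ent_eqxx _ _) (ent_eq_sym (ent_and_r _ _)).
apply: ent_ex_elim; apply: ent_cut (ent_or_l _ _).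
apply: (ent_lt_intro (w := Var ord_max)).
move/ent_fwk: add_z; rewrite /fwk /fsubst tsubst_app2 => add_z.
apply: ent_eq_trans (add_z _).
exact: ent_app2_congr (ent_eqxx _ _) (ent_eq_sym (ent_and_r _ _)).
Qed.

(** * Bounded quantification *)

Lemma ent_ball0 n (psi : form n) phi : psi |-[n] BAll Zero phi.
Proof. by apply: ent_ball; apply: ent_cut (ent_and_r _ _) (ent_lt0 _ _). Qed.

Lemma ent_ball_succ n (psi : form n) phi t :
  psi |-[n] BAll t phi -> psi |-[n] inst phi t -> psi |-[n] BAll (Succ t) phi.
Proof.
move=> ball_phi phit; apply: ent_ball; rewrite twk_Succ.
apply: ent_or_elim (ent_cut (ent_and_r _ _) (ent_lt_succ _ _)) _ _.
  apply: ent_cut (ent_ball_inv ball_phi).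
  exact: ent_and (ent_cut (ent_and_l _ _) (ent_and_l _ _)) (ent_and_r _ _).
apply: ent_cut (ent_one_point phit).
exact: ent_and (ent_cut (ent_and_l _ _) (ent_and_l _ _)) (ent_and_r _ _).
Qed.

Lemma ent_ball_congr n (psi : form n) phi t u :
  psi |-[n] Eq t u -> psi |-[n] BAll t phi -> psi |-[n] BAll u phi.
Proof.
move=> tu /ent_ball_inv ball_phi; apply: ent_ball; apply: ent_cut ball_phi.
apply: ent_and (ent_and_l _ _) _.
exact: ent_lt_congr (ent_eqxx _ _) (ent_eq_sym (ent_fwk _ tu)) (ent_and_r _ _).
Qed.

(** * Numerals *)

Fixpoint num (n k : nat) : term n :=
  if k is k'.+1 then Succ (num n k') else Zero.

Lemma ent_ball_num n (psi : form n) phi k :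
  (forall a, a < k -> psi |-[n] inst phi (num n a)) ->
  psi |-[n] BAll (num n k) phi.
Proof.
elim: k => [_|k IH inst_phi]; first exact: ent_ball0.
by apply: ent_ball_succ (IH _) (inst_phi k _) => // a /ltnW; exact: inst_phi.
Qed.

Section Numerals.

Variables (n : nat) (psi : form n).

Lemma ent_app_num m (f : primrec m) : forall v : 'I_m -> nat,
  psi |-[n] Eq (app f (fun i => num n (v i))) (num n (PReval f v)).
Proof.
elim/primrec_nested_ind: f => {m}.
- move=> v; apply: ent_eq_trans (ent_PRzero _ (num n (v ord0))).
  by apply: ent_app_congr => i; rewrite ord1; exact: ent_eqxx.
- by move=> v; apply: ent_app_congr => i; rewrite ord1; exact: ent_eqxx.
- move=> m k v; exact: ent_PRproj.
- move=> m k h g IHh IHg v; apply: ent_eq_trans (ent_PRcomp _ _ _ _) _.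
  by apply: ent_eq_trans (IHh _); apply: ent_app_congr => i; exact: IHg.
- move=> m g h IHg IHh; elim/snoc_case => x; elim=> [|k IHk].
    rewrite PReval_rec0 (comp_snoc (num n)).
    exact: ent_eq_trans (ent_PRrec0 _ _ _ _) (IHg x).
  rewrite PReval_recS (comp_snoc (num n)).
  apply: ent_eq_trans (ent_PRrecS _ _ _ _ _) _; apply: ent_eq_trans (IHh _).
  rewrite -(comp_snoc (num n)) [X in Eq _ (app h X)](comp_snoc (num n)).
  apply: ent_app_congr.
  apply: (snoc_rel (R := fun t u => psi |-[n] Eq t u)) => // i.
  exact: ent_eqxx.
Qed.

Lemma ent_tsubst_num m (v : 'I_m -> nat) t :
  psi |-[n] Eq (tsubst (fun i => num n (v i)) t) (num n (teval v t)).
Proof.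
elim/term_nested_ind: t => [i||k f ts IH] /=; [exact: ent_eqxx..|].
by apply: ent_eq_trans (ent_app_num f _); apply: ent_app_congr.
Qed.

Lemma ent_lt_num a b : a < b -> psi |-[n] Lt (num n a) (num n b).
Proof.
move=> lt_ab; apply: (ent_lt_intro (w := num n (b - a.+1))).
have := ent_app_num PRadd (snoc (fun=> a) (b - a.+1).+1).
by rewrite PReval_PRadd (comp_snoc (num n)) addnS -addSn subnKC.
Qed.

Lemma sat_ent_fsubst_num m (phi : form m) : forall v : 'I_m -> nat,
  sat v phi -> psi |-[n] fsubst (fun i => num n (v i)) phi.
Proof.
elim: phi => {m} /=.
- by move=> m v _; exact: ent_top.
- by [].
- move=> m t u v tu; apply: ent_eq_trans (ent_tsubst_num v t) _; rewrite tu.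
  exact: ent_eq_sym (ent_tsubst_num v u).
- move=> m t u v /ent_lt_num.
  by apply: ent_lt_congr; apply: ent_eq_sym; exact: ent_tsubst_num.
- move=> m phi IHphi chi IHchi v [/IHphi ent_phi /IHchi ent_chi].
  exact: ent_and.
- move=> m phi IHphi chi IHchi v [/IHphi ent_phi|/IHchi ent_chi].
    exact: ent_cut ent_phi (ent_or_l _ _).
  exact: ent_cut ent_chi (ent_or_r _ _).
- move=> m phi IH v [a /IH]; rewrite (comp_snoc (num n)) -inst_fsubst_up.
  exact: ent_ex_intro.
- move=> m t phi IH v sat_phi.
  apply: ent_ball_congr (ent_eq_sym (ent_tsubst_num v t)) _.
  apply: ent_ball_num => a /sat_phi/IH.
  by rewrite (comp_snoc (num n)) -inst_fsubst_up.
Qed.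

End Numerals.

Theorem theorem7p3 (phi : sentence) : provable phi <-> true_in_N phi.
Proof.
split=> [/entails_sound|phi_true]; first exact.
suff <- : fsubst (fun i : 'I_0 => num 0 0) phi = phi.
  exact: (sat_ent_fsubst_num _ phi_true).
rewrite -[RHS]fsubst_id; congr fsubst.
by apply: functional_extensionality => -[].
Qed.
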